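(* Given a random graph $G(n,m)$, there exists a single pass semi-streaming algorithm for maintaining a data structure that answers strong connectivity queries in $G$ incrementally, requiring $O(n\log n)$ space.
   Context: $G=G(n,m)$ is the random (directed) graph on $n$ vertices consisting of the first $m$ edges of a uniformly random permutation of all possible (directed) edges; the edges arrive as a stream in this order. Semi-streaming model: the input can be accessed only sequentially, in the form of a stream, and the size of the working memory is $\tilde O(n)$, i.e. $O(n)$ up to polylogarithmic factors. A single pass algorithm reads the stream once. A strong connectivity query asks whether two given vertices lie in the same strongly connected component of the graph. Incrementally means that the data structure is maintained under the insertion of edges, so that queries refer to the graph formed by the edges inserted so far. *)

(* Defs.v *)
From mathcomp Require Import all_boot all_order all_algebra all_fingroup.
From mathcomp Require Import boolp.

Set Implicit Arguments.
Unset Strict Implicit.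
Unset Printing Implicit Defensive.

Import Order.TTheory GRing.Theory Num.Theory.

Definition diedge (n : nat) : finType := {e : 'I_n * 'I_n | e.1 != e.2}.

Definition strongly_connected n (es : seq (diedge n)) (u v : 'I_n) : bool :=
  let adj := [rel x y | (x, y) \in map val es] in
  connect adj u v && connect adj v u.

(* The permutation s lists the possible edges in the order
   s e_0, s e_1, ..., where e_0, e_1, ... is the fixed enumeration [enum]. *)
Definition stream n (m : nat) (s : {perm diedge n}) : seq (diedge n) :=
  take m [seq s e | e <- enum {: diedge n}].

Definition uniform_prob (T : finType) (P : T -> Prop) : rat :=
  (#|[set x | `[< P x >]]|%:R / #|T|%:R)%R.

(* The memory is an array of natural numbers.  Expressions can read it with
   computed addresses; [eLeq] yields 1 or 0 and [eSub] is truncated. *)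
Inductive expr :=
  | eConst of nat
  | eLoad of expr
  | eAdd of expr & expr
  | eSub of expr & expr
  | eMul of expr & expr
  | eLeq of expr & expr.

Inductive cmd :=
  | cSkip
  | cStore of expr & expr   (* address, value *)
  | cSeq of cmd & cmd
  | cIf of expr & cmd & cmd
  | cWhile of expr & cmd.

Definition memory := nat -> nat.

Definition write (mem : memory) (a x : nat) : memory :=
  fun b => if b == a then x else mem b.

Fixpoint eval (mem : memory) (e : expr) : nat :=
  match e with
  | eConst k => k
  | eLoad a => mem (eval mem a)
  | eAdd a b => eval mem a + eval mem b
  | eSub a b => eval mem a - eval mem b
  | eMul a b => eval mem a * eval mem b
  | eLeq a b => eval mem a <= eval mem b
  end.

(* [fits S W mem e]: evaluating e only reads cells of address < S, and all
   intermediate results are < W. *)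
Fixpoint fits (S W : nat) (mem : memory) (e : expr) : bool :=
  (eval mem e < W) &&
  match e with
  | eConst _ => true
  | eLoad a => fits S W mem a && (eval mem a < S)
  | eAdd a b | eSub a b | eMul a b | eLeq a b => fits S W mem a && fits S W mem b
  end.

(* [exec S W c mem mem']: started in mem, c terminates in mem', and does so
   using only the S cells of address < S, each holding a word < W.  There is no
   rule for an execution that would exceed these bounds. *)
Inductive exec (S W : nat) : cmd -> memory -> memory -> Prop :=
  | ExSkip mem : exec S W cSkip mem mem
  | ExStore a e mem :
      fits S W mem a -> fits S W mem e -> eval mem a < S ->
      exec S W (cStore a e) mem (write mem (eval mem a) (eval mem e))
  | ExSeq c1 c2 mem mem1 mem2 :
      exec S W c1 mem mem1 -> exec S W c2 mem1 mem2 ->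
      exec S W (cSeq c1 c2) mem mem2
  | ExIf e c1 c2 mem mem' :
      fits S W mem e ->
      exec S W (if eval mem e != 0 then c1 else c2) mem mem' ->
      exec S W (cIf e c1 c2) mem mem'
  | ExWhile e c mem mem' :
      fits S W mem e ->
      exec S W (if eval mem e != 0 then cSeq c (cWhile e c) else cSkip) mem mem' ->
      exec S W (cWhile e c) mem mem'.

(* One program for each event, uniform in n and m.  Calling convention: before
   [init] runs, cell 0 holds n and all the other cells hold 0; before [insert]
   or [query] runs, the two vertices concerned are put in cells 1 and 2; after
   [query], the answer is "yes" iff cell 3 is nonzero.  The memory is the only
   thing kept from one event to the next. *)
Record algorithm := Algorithm { init : cmd; insert : cmd; query : cmd }.

Inductive event n :=
  | Insert of diedge n
  | Query of 'I_n & 'I_n.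

Definition inserted n (evs : seq (event n)) : seq (diedge n) :=
  pmap (fun ev => if ev is Insert e then Some e else None) evs.

Definition pass_args n (mem : memory) (u v : 'I_n) : memory :=
  write (write mem 1 u) 2 v.

(* [serves A S W es mem evs]: from memory mem, the edges es having already been
   inserted, the algorithm processes evs within S cells of words < W, and
   answers every query correctly for the graph inserted so far. *)
Fixpoint serves n (A : algorithm) (S W : nat)
    (es : seq (diedge n)) (mem : memory) (evs : seq (event n)) : Prop :=
  match evs with
  | [::] => True
  | Insert e :: evs' =>
      exists2 mem', exec S W (insert A) (pass_args mem (val e).1 (val e).2) mem'
                  & serves A S W (rcons es e) mem' evs'
  | Query u v :: evs' =>
      exists mem', [/\ exec S W (query A) (pass_args mem u v) mem',
                       (mem' 3 != 0) = strongly_connected es u v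
                     & serves A S W es mem' evs']
  end.

(* On the stream es, with arbitrary queries interleaved between the edges. *)
Definition maintains_strong_connectivity n (A : algorithm) (S W : nat)
    (es : seq (diedge n)) : Prop :=
  exists2 mem, exec S W (init A) (write (fun=> 0) 0 n) mem
             & forall evs, inserted evs = es -> serves A S W [::] mem evs.

(* Main.v *)
(* The algorithm stores an arriving edge (u, v) only if v is not yet reachable
   from u through stored edges; the stored graph then has the same reachability
   relation as the whole graph, and nothing is stored once the graph is strongly
   connected.  So it suffices that the first L = O(n log n) edges of G(n,m) make
   the graph strongly connected with high probability.  Otherwise those L edges
   avoid all the a (n - a) edges leaving some vertex set of size a, which has
   probability at most (1 - a (n - a) / (n (n - 1)))^L <= n^(-b (c + 2)) with
   b = min(a, n - a), and a union bound over the at most n^b sets of each size a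
   concludes. *)
Require Import Defs.
From mathcomp Require Import all_boot all_order all_algebra all_fingroup.
From mathcomp Require Import boolp zify.

Set Implicit Arguments.
Unset Strict Implicit.
Unset Printing Implicit Defensive.

Import Order.TTheory GRing.Theory Num.Theory.

(** * Permutations that avoid a set on given positions *)

Definition avoiding (T : finType) (X : {set T}) (r : seq T) : {set {perm T}} :=
  [set s : {perm T} | all (fun e => s e \notin X) r].

(* Composing s with the transposition of s e and x maps a pair (s, x), where s
   avoids X on r and x is in X, injectively to a pair (s', s e), where s' avoids
   X on r but s' e = x is in X. *)
Lemma card_avoiding_cons (T : finType) (X : {set T}) e r : e \notin r ->
  #|avoiding X (e :: r)| * #|T| <= #|avoiding X r| * (#|T| - #|X|).
Proof.
move=> er; set hit := [set s in avoiding X r | s e \in X].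
have hitP : #|avoiding X r| * #|X| <= #|hit| * #|T|.
  rewrite -cardsX -cardsT -cardsX.
  pose f (p : {perm T} * T) := ((p.1 * tperm (p.1 e) p.2)%g, p.1 e).
  have f_inj : injective f.
    move=> [s x] [s' x'] [/= eq_s eq_e].
    have eq_x : x = x'.
      by have := congr1 (fun t : {perm T} => t e) eq_s; rewrite !permM !tpermL.
    by move: eq_s; rewrite eq_e eq_x => /mulIg ->.
  rewrite -(card_imset _ f_inj); apply/subset_leq_card/subsetP => _ /imsetP[[s x] + ->].
  rewrite !inE /= => /andP[/allP sX xX]; rewrite andbT permM tpermL xX andbT.
  apply/allP => y yr; rewrite permM tpermD ?sX //.
    by rewrite (inj_eq perm_inj); apply: contraNneq er => ->.
  by apply: contraTneq xX => ->; rewrite sX.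
have -> : #|avoiding X (e :: r)| = #|avoiding X r| - #|hit|.
  rewrite -(cardsID [set s : {perm T} | s e \in X] (avoiding X r)) -setIdE addKn.
  by apply: eq_card => s; rewrite !inE /= andbC.
by rewrite mulnBl mulnBr leq_sub2l.
Qed.

(** Each further position costs a factor 1 - |X| / |T| by [card_avoiding_cons], so a random
    permutation avoids [X] on [r] with probability at most (1 - |X| / |T|) ^ |r|. Denominators are
    cleared to stay in [nat]. *)
Lemma card_avoiding (T : finType) (X : {set T}) r : uniq r ->
  #|avoiding X r| * #|T| ^ size r <= #|T|`! * (#|T| - #|X|) ^ size r.
Proof.
elim: r => [_|e r IH /= /andP[er /IH{}IH]].
  rewrite !muln1 -cardsT -card_perm; apply/subset_leq_card/subsetP => s _.
  by apply/subsetP => x; rewrite inE.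
have := card_avoiding_cons X er; set a := #|avoiding X (e :: r)| => le_a.
rewrite !expnS mulnA (leq_trans (leq_mul le_a (leqnn _))) //.
by rewrite mulnAC [X in _ <= _ * X]mulnC mulnA leq_mul2r IH orbT.
Qed.

(** * Counting the edges that leave a vertex set *)

Definition crossing n (A : {set 'I_n}) : {set diedge n} :=
  [set e | ((val e).1 \in A) && ((val e).2 \notin A)].

Lemma card_crossing n (A : {set 'I_n}) : #|crossing A| = #|A| * (n - #|A|).
Proof.
have -> : n - #|A| = #|~: A| by rewrite [RHS]cardsCs setCK card_ord.
rewrite -cardsX.
rewrite -(card_imset _ val_inj); apply: eq_card => -[x y].
rewrite !inE /=; apply/imsetP/andP => [[e + xyE]|[xA yA]].
  have [-> ->] : x = (val e).1 /\ y = (val e).2 by rewrite /= -xyE.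
  by rewrite inE => /andP[].
have xy : x != y by apply: contraTneq xA => ->.
by exists (Sub (x, y) xy); rewrite ?inE //= xA.
Qed.

Lemma card_diedge n : #|{: diedge n}| = n * (n - 1).
Proof.
rewrite card_sig.
have := cardC [pred e : 'I_n * 'I_n | e.1 != e.2].
have -> : #|[predC [pred e : 'I_n * 'I_n | e.1 != e.2]]| = n.
  rewrite -[RHS]card_ord -(card_imset _ (f := fun x : 'I_n => (x, x))); last by move=> ? ? [].
  apply: eq_card => -[x y]; rewrite !inE negbK; apply/eqP/imsetP => [/= ->|[z _ [-> ->]] //].
  by exists y.
by rewrite card_prod card_ord mulnBr muln1 => <-; rewrite addnK.
Qed.

(** * Numerical estimates, with denominators cleared *)

Lemma leq_bin_expn n k : 'C(n, k) <= n ^ k.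
Proof.
apply: (@leq_trans (n ^_ k)); first by rewrite -bin_ffact leq_pmulr ?fact_gt0.
elim: k n => // k IH [|n]; first by rewrite ffact0n.
rewrite ffactSS expnS leq_mul2l /= (leq_trans (IH n)) //.
by case: (k) => // k'; rewrite leq_exp2r.
Qed.

(** This is (1 - 1/M)^M <= 1/2: the first two terms of the binomial expansion of ((M - 1) + 1)^M
    already add up to at least 2 (M - 1)^M. *)
Lemma expn_pred_half M : 0 < M -> 2 * M.-1 ^ M <= M ^ M.
Proof.
case: M => [|[|M]]; rewrite ?exp1n //=.
have : M.+1 ^ M.+2 + M.+2 * M.+1 ^ M.+1 <= M.+2 ^ M.+2.
  rewrite -{3}[M.+2]addn1 expnDn big_ord_recl /= big_ord_recl /=.
  by rewrite !bin0 !exp1n !muln1 mul1n bin1 addnA /bump /= addn0 subSS subn0 leq_addr.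
move=> h _; apply: leq_trans h; rewrite mul2n -addnn leq_add2l [X in X <= _]expnS.
by rewrite leq_mul2r leqnSn orbT.
Qed.

(** Bernoulli's inequality 1 - b/M <= (1 - 1/M)^b. *)
Lemma bernoulli M b : b <= M -> (M - b) * M ^ b <= M * M.-1 ^ b.
Proof.
elim: b => [|b IH ltbM]; first by rewrite subn0.
have {}IH := IH (ltnW ltbM).
rewrite !expnS; case: M ltbM IH => // M ltbM IH /=.
have {}IH := leq_mul (leqnn M) IH.
rewrite [X in _ <= X]mulnCA; apply: leq_trans IH; rewrite !mulnA leq_mul2r.
by apply/orP; right; nia.
Qed.

(** By Bernoulli, (1 - b/M)^M is at most ((1 - 1/M)^M)^b, hence at most 2^(-b). *)
Lemma expn_sub_half M b : 0 < M -> b <= M -> 2 ^ b * (M - b) ^ M <= M ^ M.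
Proof.
move=> M0 leb; have Mb0 : 0 < (M ^ b) ^ M by rewrite !expn_gt0 M0.
rewrite -(leq_pmul2r Mb0) -mulnA -expnMn.
have h : ((M - b) * M ^ b) ^ M <= (M * M.-1 ^ b) ^ M by rewrite leq_exp2r // bernoulli.
apply: (leq_trans (leq_mul (leqnn _) h)).
rewrite expnMn mulnCA leq_mul2l -!expnM [b * M]mulnC !expnM -expnMn.
by apply/orP; right; case: b {leb Mb0 h} => // b; rewrite leq_exp2r // expn_pred_half.
Qed.

(** * Union bound over the vertex cuts *)

Lemma card_not_strongly_connected n L c : 1 < n -> L <= n * (n - 1) ->
  L = 4 * (n * trunc_log 2 n) * (c + 2) ->
  #|[set s : {perm diedge n} | [exists u, exists v, ~~ strongly_connected (stream L s) u v]]|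
    * n ^ c <= #|{perm diedge n}|.
Proof.
move=> n1 leLN LE; set bad := [set s | _].
pose r := take L (enum {: diedge n}).
have r_uniq : uniq r by rewrite take_uniq // enum_uniq.
have size_r : size r = L by rewrite size_takel // -cardT card_diedge.
have streamE s : stream L s = map s r by rewrite map_take.
pose avoids (A : {set 'I_n}) := avoiding (crossing A) r.
have sub_bad : bad \subset \bigcup_(A : {set 'I_n} | 0 < #|A| < n) avoids A.
  apply/subsetP => s; rewrite inE => bad_s.
  have {bad_s}[u [v nuv]] : exists u, exists v,
      ~~ connect [rel x y | (x, y) \in map val (stream L s)] u v.
    case/existsP: bad_s => u /existsP[v]; rewrite negb_and => /orP[nuv|nvu].
      by exists u, v.
    by exists v, u.
  (* The cut is the set of vertices reachable from [u]; an edge of the prefix leaving it would make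
     its target reachable too. *)
  pose A := [set x | connect [rel x y | (x, y) \in map val (stream L s)] u x].
  have uA : u \in A by rewrite inE connect0.
  have vA : v \notin A by rewrite inE.
  apply/bigcupP; exists A.
    apply/andP; split; first by apply/card_gt0P; exists u.
    rewrite -[n in _ < n]card_ord -cardsT proper_card // properE subsetT.
    by apply/subsetPn; exists v.
  rewrite inE; apply/allP => e er; rewrite !inE; apply/negP => /andP[con /negP[]].
  apply: connect_trans con (connect1 _); rewrite /= -surjective_pairing.
  by rewrite map_f // streamE map_f.
have card_perms : #|{perm diedge n}| = (n * (n - 1))`!.
  have := card_perm [set: diedge n]; rewrite cardsT card_diedge => <-.
  by apply: eq_card => s; rewrite inE; apply/esym/subsetP => x; rewrite inE.
have card_avoids (A : {set 'I_n}) : 0 < #|A| < n ->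
    #|avoids A| * n ^ (minn #|A| (n - #|A|) * (c + 2)) <= (n * (n - 1))`!.
  move=> A_bd; set b := minn _ _.
  have := card_avoiding (crossing A) r_uniq; rewrite size_r card_diedge card_crossing.
  set K := #|A| * _; set N := n * _; move=> avoidN.
  (* A cut contains a fraction at least b / (2 n) of all edges, because its larger side has at least
     n / 2 vertices. *)
  have KN : (N - K) * (2 * n) <= N * (2 * n - b).
    rewrite mulnBl mulnBr leq_sub2l // /N /K /b; nia.
  have NKL : (N - K) ^ L * n ^ (b * (c + 2)) <= N ^ L.
    have n20 : 0 < (2 * n) ^ L by rewrite expn_gt0; lia.
    rewrite -(leq_pmul2r n20) mulnAC -expnMn.
    apply: (@leq_trans ((N * (2 * n - b)) ^ L * n ^ (b * (c + 2)))).
      by rewrite leq_mul2r; apply/orP; right; case: (L) => // L'; rewrite leq_exp2r.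
    rewrite expnMn -mulnA leq_mul2l; apply/orP; right.
    (* The prefix is cut into [q] blocks of length 2 n; by [expn_sub_half] each block contributes a
       factor 2^(-b). *)
    have -> : L = 2 * n * (2 * trunc_log 2 n * (c + 2)) by rewrite LE; nia.
    rewrite mulnC; set q := 2 * trunc_log 2 n * (c + 2).
    have nq : n ^ (b * (c + 2)) <= (2 ^ b) ^ q.
      have /andP[_ /ltnW n2] := trunc_log_bounds (isT : 1 < 2) (ltnW n1).
      have l0 : 0 < trunc_log 2 n by rewrite trunc_log_gt0 //.
      (* Doubling the exponent makes up for the rounding in [trunc_log]; this and the block length 2
         n account for the factor 4 in [L]. *)
      have {}n2 : n <= 2 ^ (2 * trunc_log 2 n).
        by apply: leq_trans n2 _; rewrite leq_exp2l //; lia.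
      apply: (@leq_trans ((2 ^ (2 * trunc_log 2 n)) ^ (b * (c + 2)))).
        by case: (b * _) => // k; rewrite leq_exp2r.
      by rewrite -!expnM leq_exp2l // /q; nia.
    apply: (leq_trans (leq_mul nq (leqnn _))).
    rewrite [X in _ * X]expnM [X in _ <= X]expnM -expnMn.
    by case: (q) => // q'; rewrite leq_exp2r // expn_sub_half // /b; lia.
  have N0 : 0 < N ^ L by rewrite expn_gt0 muln_gt0 subn_gt0 n1 (ltnW n1).
  rewrite -(leq_pmul2r N0) mulnAC (leq_trans (leq_mul avoidN (leqnn _))) //.
  by rewrite -mulnA leq_mul2l NKL orbT.
(* Since b >= 1, the exponent b (c + 2) is at least c + 1 + b: it pays for the target n^c, for the
   at most n cut sizes, and for the at most n^b cuts of one size. *)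
have weight_avoids (A : {set 'I_n}) : 0 < #|A| < n ->
    #|avoids A| * n ^ c * (n * 'C(n, #|A|)) <= (n * (n - 1))`!.
  move=> A_bd; apply: leq_trans (card_avoids A A_bd).
  rewrite -mulnA leq_mul2l; apply/orP; right.
  have C_le : 'C(n, #|A|) <= n ^ minn #|A| (n - #|A|).
    have [_|_] := leqP #|A| (n - #|A|); first exact: leq_bin_expn.
    by rewrite -bin_sub ?leq_bin_expn //; lia.
  rewrite mulnA -expnSr; apply: leq_trans (leq_mul (leqnn _) C_le) _.
  by rewrite -expnD leq_exp2l //; nia.
have sum_avoids : \sum_(A : {set 'I_n} | 0 < #|A| < n) #|avoids A| * n ^ c <= (n * (n - 1))`!.
  pose ord_card (A : {set 'I_n}) : 'I_n.+1 := inord #|A|.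
  rewrite (partition_big ord_card (fun k : 'I_n.+1 => 0 < k < n)) /ord_card /=; last first.
    by move=> A A_bd; rewrite inordK //; lia.
  rewrite -(leq_pmul2l (ltnW n1)) big_distrr /=.
  have le_sum : \sum_(k < n.+1 | 0 < k < n) (n * (n - 1))`! <= n * (n * (n - 1))`!.
    rewrite sum_nat_const leq_mul2r; apply/orP; right.
    apply: (@leq_trans #|predC1 (ord0 : 'I_n.+1)|); last by rewrite cardC1 card_ord.
    apply/subset_leq_card/subsetP => k; rewrite !inE => /andP[k0 _].
    by rewrite -val_eqE /= -lt0n.
  apply: leq_trans le_sum; apply: leq_sum => k k_bd.
  have C0 : 0 < 'C(n, k) by rewrite bin_gt0; lia.
  (* Scaling by the number of sets of size [k] lets [weight_avoids] bound the sum term by term. *)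
  rewrite -(leq_pmul2r C0) mulnAC big_distrr /=.
  apply: (@leq_trans (\sum_(A : {set 'I_n} | #|A| == k) (n * (n - 1))`!)); last first.
    by rewrite sum_nat_const -cardsE card_draws card_ord mulnC.
  rewrite [X in _ <= X]big_mkcond [X in X <= _]big_mkcond /=.
  apply: leq_sum => A _; case: ifP => // /andP[A_bd /eqP <-].
  by rewrite inordK; [rewrite eqxx mulnC weight_avoids | lia].
rewrite card_perms (leq_trans _ sum_avoids) // -big_distrl leq_mul2r.
apply/orP; right; apply: leq_trans (subset_leq_card sub_bad) _.
elim/big_rec2: _ => [|A B_ k _]; first by rewrite cards0.
by rewrite -(leq_add2l #|avoids A|); apply/leq_trans/leq_card_setU.
Qed.

(** * Total-correctness rules for commands, resource bounds included *)

Definition wp S W c (Q : memory -> Prop) mem := exists2 mem', exec S W c mem mem' & Q mem'.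

Lemma wp_imp S W c (Q Q' : memory -> Prop) mem :
  wp S W c Q mem -> (forall mem, Q mem -> Q' mem) -> wp S W c Q' mem.
Proof. by move=> [mem' ex_c Qmem'] QQ'; exists mem' => //; apply: QQ'. Qed.

Lemma wp_skip S W (Q : memory -> Prop) mem : Q mem -> wp S W cSkip Q mem.
Proof. by exists mem => //; constructor. Qed.

Lemma wp_store S W a e (Q : memory -> Prop) mem :
  [&& fits S W mem a, fits S W mem e & eval mem a < S] ->
  Q (write mem (eval mem a) (eval mem e)) -> wp S W (cStore a e) Q mem.
Proof. by case/and3P=> fa fe aS Qw; eexists; [constructor | exact: Qw]. Qed.

Lemma wp_seq S W c1 c2 Q mem :
  wp S W c1 (wp S W c2 Q) mem -> wp S W (cSeq c1 c2) Q mem.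
Proof. by move=> [mem1 ex1 [mem2 ex2 Q2]]; exists mem2 => //; econstructor; eassumption. Qed.

Lemma wp_if S W e c1 c2 Q mem : fits S W mem e ->
  wp S W (if eval mem e != 0 then c1 else c2) Q mem -> wp S W (cIf e c1 c2) Q mem.
Proof. by move=> fe [mem' ex Q']; exists mem' => //; constructor. Qed.

(** * Counting loops and the programs of the algorithm *)

Definition var x := eLoad (eConst x).

Definition assign x := cStore (eConst x).

(** The truncated difference is nonzero exactly while the counter is below the bound held in cell
    [y]. *)
Definition for_ x y c :=
  cSeq (assign x (eConst 0))
       (cWhile (eSub (var y) (var x)) (cSeq c (assign x (eAdd (var x) (eConst 1))))).

(** [J j] is the invariant before round [j]. The body must leave the counter at [j], and the
    invariant is restored only after the increment. *)
Lemma wp_for S W x y c N (J : nat -> memory -> Prop) Q mem :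
  maxn x y < minn S W -> maxn N 1 < W ->
  (forall j mem, J j mem -> mem x = j /\ mem y = N) ->
  (forall j mem, j < N -> J j mem ->
     wp S W c (fun mem' => mem' x = j /\ J j.+1 (write mem' x j.+1)) mem) ->
  J 0 (write mem x 0) -> (forall mem, J N mem -> Q mem) ->
  wp S W (for_ x y c) Q mem.
Proof.
move=> ltxy ltNW JE Jc J0 JQ; apply: wp_seq; apply: wp_store => /=; first by lia.
(* Induction on the number [k] of remaining rounds, the current index being N - k. *)
have: exists2 k, k <= N & J (N - k) (write mem x 0) by exists N; rewrite ?subnn.
move: (write mem x 0) => {J0}mem' [k].
elim: k mem' => [|k IH] {}mem lekN Jmem; have [memx memy] := JE _ _ Jmem.
  rewrite subn0 in Jmem memx; exists mem; last exact: JQ.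
  by constructor; rewrite /= memx memy ?subnn /=; [lia | constructor].
have [|mem1 ex1 [mem1x J1]] := Jc _ _ _ Jmem; first by lia.
have [||mem2 ex2 Q2] := IH (write mem1 x (N - k.+1).+1); first by lia.
  by rewrite -subnSK.
exists mem2 => //; constructor; first by rewrite /= memx memy; lia.
have -> : eval mem (eSub (var y) (var x)) != 0 by rewrite /= memx memy; lia.
econstructor; last exact: ex2.
econstructor; first exact: ex1.
have -> : (N - k.+1).+1 = eval mem1 (eAdd (var x) (eConst 1)) by rewrite /= mem1x addn1.
constructor => /=; rewrite ?mem1x; lia.
Qed.

(* Cell 4 holds the number of stored edges, cells 5 and 6 are loop counters,
   cell 7 + i is the mark of vertex i in a graph search, and edge number j
   occupies the two cells from 7 + n + 2 * j on. *)
Definition mark a := eAdd (eConst 7) a.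
Definition source j := eAdd (eAdd (eConst 7) (var 0)) (eMul (eConst 2) j).
Definition target j := eAdd (source j) (eConst 1).

Definition scan_cmd :=
  for_ 6 4 (cIf (eLoad (mark (eLoad (source (var 6)))))
                (cStore (mark (eLoad (target (var 6)))) (eConst 1)) cSkip).

Definition reach_cmd :=
  cSeq (for_ 5 0 (cStore (mark (var 5)) (eConst 0)))
  (cSeq (cStore (mark (var 1)) (eConst 1))
        (for_ 5 0 scan_cmd)).

Definition insert_cmd :=
  cSeq reach_cmd
       (cIf (eLoad (mark (var 2))) cSkip
            (cSeq (cStore (source (var 4)) (var 1))
            (cSeq (cStore (target (var 4)) (var 2))
                  (assign 4 (eAdd (var 4) (eConst 1)))))).

(** Cell 3 keeps [u] while the second search starts from [v]; the mark of [u] then overwrites it as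
    the answer. *)
Definition query_cmd :=
  cSeq reach_cmd
       (cIf (eLoad (mark (var 2)))
            (cSeq (assign 3 (var 1))
            (cSeq (assign 1 (var 2))
            (cSeq reach_cmd (assign 3 (eLoad (mark (var 3)))))))
            (assign 3 (eConst 0))).

Definition strong_connectivity := Algorithm cSkip insert_cmd query_cmd.

(** * Reachability by repeated scans of the edge list *)

Section Correctness.
Variable n : nat.
Implicit Types (H es : seq (diedge n)) (M : {set 'I_n}) (mem : memory).

Definition adj es : rel 'I_n := [rel x y | (x, y) \in map val es].

(** Marks set early in a scan are already used later in the same scan, so one scan may follow
    several edges; only one is needed below. *)
Definition relax M (e : diedge n) := if (val e).1 \in M then (val e).2 |: M else M.
Definition scan H M := foldl relax M H.

Lemma sub_scan H M : M \subset scan H M.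
Proof.
elim: H M => //= e H IH M; apply: subset_trans (IH _); rewrite /relax.
by case: ifP => // _; apply: subsetUr.
Qed.

Lemma scan_adj H M x y : x \in M -> adj H x y -> y \in scan H M.
Proof.
rewrite /adj /=; elim: H M => //= e H IH M xM; rewrite inE => /predU1P[xyE|/IH]; last first.
  by apply; rewrite /relax; case: ifP => // _; rewrite inE xM orbT.
apply: (subsetP (sub_scan _ _)); rewrite /relax.
have [<- <-] : x = (val e).1 /\ y = (val e).2 by rewrite /= -xyE.
by rewrite xM setU11.
Qed.

Lemma scan_connect H M u : (forall x, x \in M -> connect (adj H) u x) ->
  forall x, x \in scan H M -> connect (adj H) u x.
Proof.
(* The fold runs over a shrinking list while adjacency stays that of [H]; the induction needs only
   that the list is contained in [H]. *)
have: {subset H <= H} by [].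
rewrite /scan; elim: {1 4}H M => //= e K IH M sub_K Mu; apply: IH.
  by move=> x xK; rewrite sub_K // inE xK orbT.
move=> x; rewrite /relax; case: ifP => [eM|_ /Mu //].
rewrite in_setU1 => /predU1P[->|/Mu //]; apply: connect_trans (Mu _ eM) (connect1 _).
by rewrite /adj /= -surjective_pairing map_f // sub_K // mem_head.
Qed.

(** Every scan advances by at least one edge, and a reachable vertex is reached by a path without
    repeated vertices, hence with fewer than n edges. *)
Lemma iter_scan H u : iter n (scan H) [set u] = [set x | connect (adj H) u x].
Proof.
have sub_connect k x : x \in iter k (scan H) [set u] -> connect (adj H) u x.
  elim: k x => /= [|k IH] x; first by rewrite inE => /eqP->; apply: connect0.
  exact: scan_connect.
have path_sub k p : path (adj H) u p -> size p <= k -> last u p \in iter k (scan H) [set u].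
  elim/last_ind: p k => [k _ _|p y IH [|k]]; last 2 first.
  - by rewrite size_rcons.
  - rewrite rcons_path size_rcons last_rcons /= => /andP[pp py] sz_p.
    by apply: scan_adj py; apply: IH.
  by elim: k => [|k IH]; rewrite ?set11 //=; apply: (subsetP (sub_scan _ _)).
apply/setP => x; rewrite inE; apply/idP/idP => [/sub_connect //|].
case/connectP => _ /shortenP[p pp up _] ->; apply: path_sub pp _.
by have := max_card (mem (u :: p)); rewrite card_ord (card_uniqP up) /= => /ltnW.
Qed.

(** * Sparsification of the stream *)

Definition keep H (e : diedge n) :=
  if connect (adj H) (val e).1 (val e).2 then H else rcons H e.
Definition kept es := foldl keep [::] es.

Lemma kept_rcons es e : kept (rcons es e) = keep (kept es) e.
Proof. by rewrite /kept -cats1 foldl_cat. Qed.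

(** Monotonicity turns a bound on the edges stored at the end into one valid throughout the pass. *)
Lemma size_kept_cat es es' : size (kept es) <= size (kept (es ++ es')).
Proof.
elim/last_ind: es' => [|es' e IH]; first by rewrite cats0.
rewrite -rcons_cat kept_rcons (leq_trans IH) // /keep; case: ifP => //.
by rewrite size_rcons.
Qed.

Lemma size_kept es : size (kept es) <= size es.
Proof.
elim/last_ind: es => // es e IH; rewrite kept_rcons /keep size_rcons.
by case: ifP => _; rewrite ?size_rcons // (leq_trans IH).
Qed.

(** By induction on the stream: a rejected edge can be replaced, wherever a path uses it, by a path
    of stored edges. *)
Lemma connect_kept es : connect (adj (kept es)) =2 connect (adj es).
Proof.
elim/last_ind: es => // es e IH; rewrite kept_rcons /keep.
have adjE H x y : adj (rcons H e) x y = ((x, y) == val e) || adj H x y.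
  by rewrite /adj /= map_rcons mem_rcons inE.
have adj_sub H x y : connect (adj H) x y -> connect (adj (rcons H e)) x y.
  by apply: connect_sub => {x y} x y xy; rewrite connect1 // adjE xy orbT.
have adj_e H : adj (rcons H e) (val e).1 (val e).2.
  by rewrite adjE -surjective_pairing eqxx.
case: ifP => [con_e|_] x y; apply/idP/idP.
(* Two inclusions for a rejected edge, then two for a stored one. *)
- by rewrite IH; apply: adj_sub.
- apply: connect_sub => {x y} x y; rewrite adjE => /predU1P[xyE|xy].
    by move: con_e; rewrite -xyE.
  by rewrite IH connect1.
- apply: connect_sub => {x y} x y; rewrite adjE => /predU1P[xyE|xy].
    by have := adj_e es; rewrite -xyE => /connect1.
  by apply: adj_sub; rewrite -IH connect1.
- apply: connect_sub => {x y} x y; rewrite adjE => /predU1P[xyE|xy].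
    by have := adj_e (kept es); rewrite -xyE => /connect1.
  by apply: adj_sub; rewrite IH connect1.
Qed.

Lemma kept_cat es es' : (forall u v, connect (adj es) u v) -> kept (es ++ es') = kept es.
Proof.
move=> con; elim/last_ind: es' => [|es' e IH]; first by rewrite cats0.
by rewrite -rcons_cat kept_rcons IH /keep connect_kept con.
Qed.

(** * Memory representation and correctness of the programs *)

(** Loop counters and marks are left free, so that a search preserves the predicate; marks are
    tracked separately by [marks]. *)
Definition represents H u v z mem :=
  [/\ mem 0 = n, mem 1 = u, mem 2 = v, mem 3 = z & mem 4 = size H] /\
  forall j e, onth H j = Some e ->
    mem (7 + n + 2 * j) = (val e).1 /\ mem (7 + n + 2 * j + 1) = (val e).2.

Definition marks M mem := forall i : 'I_n, mem (7 + i) = (i \in M).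

Lemma represents_write H u v z mem a x : 4 < a < 7 + n ->
  represents H u v z mem -> represents H u v z (write mem a x).
Proof.
move=> a_bd [[m0 m1 m2 m3 m4] mE].
have wE b : (b <= 4) || (7 + n <= b) -> write mem a x b = mem b.
  by move=> b_bd; rewrite /write ifN //; lia.
by split=> [|j e /mE]; rewrite !wE //; lia.
Qed.

Lemma marks_write M mem a x : a < 7 -> marks M mem -> marks M (write mem a x).
Proof. by move=> a7 mM i; rewrite /write ifN ?mM //; lia. Qed.

Lemma marks_setU1 M mem (y : 'I_n) : marks M mem -> marks (y |: M) (write mem (7 + y) 1).
Proof.
by move=> mM i; rewrite /write eqn_add2l val_eqE !inE; case: eqP => // _; apply: mM.
Qed.

(** [B] bounds the number of stored edges. The layout ends at address 7 + n + 2 B, which also bounds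
    every vertex and counter a word has to hold. *)
Variables (B S W : nat).
Hypotheses (BS : 7 + n + 2 * B <= S) (BW : 7 + n + 2 * B < W).

Lemma represents_edge H u v z mem j : j < size H -> represents H u v z mem ->
  exists2 e, take j.+1 H = rcons (take j H) e &
    mem (7 + n + 2 * j) = (val e).1 /\ mem (7 + n + 2 * j + 1) = (val e).2.
Proof.
move=> ltjH [_ mE]; move: (ltjH); rewrite -onthTE; case He: (onth H j) => [e|] // _.
by exists e; [rewrite (take_nth e ltjH) (onth_nth _ _ _ _ He) | apply: mE].
Qed.

(** The loop invariant is the scan of a prefix of [H]. Cell 5 is tracked because it is the counter
    of the enclosing loop in [reach_cmd]. *)
Lemma wp_scan H M u v z i mem : size H <= B ->
  represents H u v z mem -> marks M mem -> mem 5 = i ->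
  wp S W scan_cmd
    (fun mem' => [/\ represents H u v z mem', marks (scan H M) mem' & mem' 5 = i]) mem.
Proof.
move=> HB rep mM mem5.
pose J j mem' := [/\ represents H u v z mem', marks (scan (take j H) M) mem',
  mem' 5 = i & mem' 6 = j].
apply: (wp_for (N := size H) (J := J)) => //; try lia.
- by move=> j mem' [[[]]].
- move=> j {}mem ltjH [{}rep {}mM {}mem5 mem6].
  have [e taken [me1 me2]] := represents_edge ltjH rep.
  have [[m0 _ _ _ _] _] := rep.
  have mk1 := mM (val e).1.
  apply: wp_if; first by rewrite /= m0 mem6 me1 mk1; have := ltn_ord (val e).1; lia.
  have step (M' : {set 'I_n}) mem' :
      marks M' mem' -> represents H u v z mem' -> mem' 5 = i -> mem' 6 = j ->
      M' = scan (take j.+1 H) M -> mem' 6 = j /\ J j.+1 (write mem' 6 j.+1).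
    move=> mM' rep' mem'5 mem'6 M'E; split=> //; split=> //.
    by rewrite -M'E; apply: marks_write.
  have scanE : scan (take j.+1 H) M = relax (scan (take j H) M) e.
    by rewrite taken /scan -cats1 foldl_cat.
  rewrite [eval _ _]/= m0 mem6 me1 mk1; case: ifP => [e1|e1].
    have v2 := ltn_ord (val e).2.
    apply: wp_store; first by rewrite /= m0 mem6 me2; lia.
    have -> : eval mem (mark (eLoad (target (var 6)))) = 7 + (val e).2.
      by rewrite /= m0 mem6 me2.
    rewrite [eval _ _]/=.
    apply: (step ((val e).2 |: scan (take j H) M)).
    + exact: marks_setU1.
    + by apply: represents_write => //; lia.
    + by [].
    + by [].
    by rewrite scanE /relax; case: ifP e1.
  apply: wp_skip; apply: step mM _ _ _ _ => //.
  by rewrite scanE /relax; case: ifP e1.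
- by split=> //; rewrite take0; apply: marks_write.
by move=> {rep mM mem5}mem [? + ? _]; rewrite take_size.
Qed.

Lemma wp_reach H (u : 'I_n) v z mem : size H <= B -> represents H u v z mem ->
  wp S W reach_cmd (fun mem' => represents H u v z mem' /\
    forall x : 'I_n, mem' (7 + x) = connect (adj H) u x) mem.
Proof.
move=> HB rep; have un := ltn_ord u; apply: wp_seq.
pose Jclear k mem' := [/\ represents H u v z mem',
  forall x, x < k -> mem' (7 + x) = 0 & mem' 5 = k].
apply: (wp_for (N := n) (J := Jclear)) => //; try lia.
- by move=> k mem' [[[]]].
- move=> k {}mem ltkn [{}rep clear mem5].
  apply: wp_store; first by rewrite /= mem5; lia.
  have kE : eval mem (mark (var 5)) = 7 + k by rewrite /= mem5.
  rewrite kE [eval _ _]/=; split=> //.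
  have rep' : represents H u v z (write mem (7 + k) 0) by apply: represents_write => //; lia.
  split=> // x; rewrite ltnS leq_eqVlt => /predU1P[->|ltxk]; rewrite /write /=; last first.
    by case: ifP => // _; apply: clear.
  by rewrite eqxx.
move=> {rep}mem [rep clear _].
have {}clear : marks set0 mem by move=> x; rewrite inE clear.
have [[_ mem1 _ _ _] _] := rep.
apply: wp_seq; apply: wp_store; first by rewrite /= mem1; lia.
have -> : eval mem (mark (var 1)) = 7 + u by rewrite /= mem1.
rewrite [eval _ _]/=.
pose J k mem' := [/\ represents H u v z mem',
  marks (iter k (scan H) [set u]) mem' & mem' 5 = k].
apply: (wp_for (N := n) (J := J)) => //; try lia.
- by move=> k mem' [[[]]].
- move=> k {rep mem1 clear}mem ltkn [rep mM mem5].
  apply: wp_imp (wp_scan HB rep mM mem5) _ => {rep mM mem5}mem [rep mM mem5].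
  by split=> //; split=> //; apply: marks_write.
- split=> //; last by rewrite /= -[[set u]]setU0; apply: marks_write => //; apply: marks_setU1.
  do 2![apply: represents_write; first by lia].
  by [].
by move=> {rep mem1 clear}mem [rep mM _]; split=> // x; rewrite mM iter_scan inE.
Qed.

(** The bound is on the list after insertion, so a new slot is required only if the edge is stored.
    Cells 1 and 2 are existential, as the next event overwrites them. *)
Lemma wp_insert H u v z (e : diedge n) mem : size (keep H e) <= B ->
  represents H u v z mem ->
  wp S W insert_cmd (fun mem' => exists u' v', represents (keep H e) u' v' z mem')
    (pass_args mem (val e).1 (val e).2).
Proof.
move=> keepB rep.
have HB : size H <= B.
  by move: keepB; rewrite /keep; case: ifP; rewrite ?size_rcons => // _ /ltnW.
have {}rep : represents H (val e).1 (val e).2 z (pass_args mem (val e).1 (val e).2).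
  by case: rep => -[].
apply: wp_seq; apply: wp_imp (wp_reach HB rep) _ => {mem}mem [{}rep mark2].
have {mark2} := mark2 (val e).2; have [[m0 m1 m2 m3 m4] mE] := rep => mark2.
have u_n := ltn_ord (val e).1; have v_n := ltn_ord (val e).2.
apply: wp_if; first by rewrite /= m2 mark2; lia.
rewrite [eval _ _]/= m2 mark2; move: keepB; rewrite /keep; case: ifP => _ keepB /=.
  by apply: wp_skip; exists (val e).1, (val e).2.
rewrite size_rcons in keepB.
set a := 7 + n + 2 * size H.
apply: wp_seq; apply: wp_store; first by rewrite /= m0 m1 m4; lia.
have -> : eval mem (source (var 4)) = a by rewrite /= m0 m4.
rewrite [eval _ _]/= m1.
have w1 b : b < a -> write mem a (val e).1 b = mem b by move=> b_a; rewrite /write ltn_eqF.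
have a1 : write mem a (val e).1 a = (val e).1 by rewrite /write eqxx.
move: (write mem a _) w1 a1 => mem1 w1 a1.
apply: wp_seq; apply: wp_store; first by rewrite /= !w1 // m0 m2 m4; lia.
have -> : eval mem1 (target (var 4)) = a + 1 by rewrite /= !w1 // m0 m4.
rewrite [eval _ _]/= w1 // m2.
have w2 b : b < a -> write mem1 (a + 1) (val e).2 b = mem b.
  by move=> b_a; rewrite /write ltn_eqF ?w1 // ltn_addr.
have a2 : write mem1 (a + 1) (val e).2 a = (val e).1 by rewrite /write ltn_eqF ?a1 // addn1.
have a3 : write mem1 (a + 1) (val e).2 (a + 1) = (val e).2 by rewrite /write eqxx.
move: (write mem1 _ _) w2 a2 a3 => {w1 a1}mem1 w1 a1 a2.
apply: wp_store; first by rewrite /= !w1 // m4; lia.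
rewrite /= w1 // m4; exists (val e).1, (val e).2; split.
  by split; rewrite /write /= ?size_rcons ?w1 ?addn1.
move=> j f; rewrite /write /=.
rewrite -cats1 onth_cat; have [ltjH /mE[s t]|leHj] := ltnP j (size H).
  by rewrite !w1 ?s ?t // /a; lia.
case Ej : (j - size H) => [|[]//] [<-].
by have -> : j = size H by lia.
Qed.

Lemma wp_query H u0 v0 z (u v : 'I_n) mem : size H <= B -> represents H u0 v0 z mem ->
  wp S W query_cmd (fun mem' => (exists u' v' z', represents H u' v' z' mem') /\
     (mem' 3 != 0) = connect (adj H) u v && connect (adj H) v u)
   (pass_args mem u v).
Proof.
move=> HB rep.
have {}rep : represents H u v z (pass_args mem u v) by case: rep => -[].
apply: wp_seq; apply: wp_imp (wp_reach HB rep) _ => {mem}mem [{}rep reach].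
have [[m0 m1 m2 m3 m4] mE] := rep.
have u_n := ltn_ord u; have v_n := ltn_ord v.
have {}reach := reach v.
apply: wp_if; first by rewrite /= m2 reach; lia.
rewrite [eval _ _]/= m2 reach; case: ifP => [|] uv; last first.
  apply: wp_store; first by rewrite /=; lia.
  by split; [exists u, v, 0 | case: connect uv].
have -> : connect (adj H) u v by case: connect uv.
apply: wp_seq; apply: wp_store; first by rewrite /= m1; lia.
apply: wp_seq; apply: wp_store; first by rewrite /= /write /= m2; lia.
rewrite /= m1 /(write _ _ _ 2) /= m2.
apply: wp_seq.
(* The second search starts from [v], with [u] saved in cell 3. *)
have rep' : represents H v v u (write (write mem 3 u) 1 v) by [].
apply: wp_imp (wp_reach HB rep') _ => {rep rep' m0 m1 m2 m3 m4 mE reach}mem [rep reach].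
have [[m0 m1 m2 m3 m4] mE] := rep; have {}reach := reach u.
apply: wp_store; first by rewrite /= m3 reach; lia.
rewrite /= m3 reach; split; first by exists v, v, (connect (adj H) v u).
by rewrite /write /=; case: connect.
Qed.

Lemma serves_kept es mem evs u v z : size (kept (es ++ inserted evs)) <= B ->
  represents (kept es) u v z mem -> serves strong_connectivity S W es mem evs.
Proof.
elim: evs es mem u v z => //= -[e|u v] evs IH es mem u0 v0 z keptB rep.
  rewrite /inserted /= -cat_rcons in keptB.
  have keepB : size (keep (kept es) e) <= B.
    by rewrite -kept_rcons (leq_trans (size_kept_cat _ _) keptB).
  have [mem' ex [u' [v' rep']]] := wp_insert keepB rep; exists mem' => //.
  by rewrite -kept_rcons in rep'; apply: IH rep'.
have HB := leq_trans (size_kept_cat _ _) keptB.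
have [mem' ex [[u' [v' [z' rep']]] ans]] := wp_query u v HB rep; exists mem'; split=> //.
  by rewrite ans !connect_kept.
exact: IH rep'.
Qed.

Lemma maintains_kept es : size (kept es) <= B ->
  maintains_strong_connectivity strong_connectivity S W es.
Proof.
move=> keptB; eexists; first by constructor.
(* The initial memory, zero except for cell 0, represents the empty edge list. *)
move=> evs evsE; apply: (@serves_kept _ _ _ 0 0 0); first by rewrite evsE.
by split=> // j e; rewrite onth0n.
Qed.

End Correctness.

(** * From counting permutations to probabilities *)

Lemma uniform_prob_ge (T : finType) (P : T -> Prop) (B : {set T}) n c :
  0 < #|T| -> 0 < n -> (forall x, x \notin B -> P x) -> #|B| * n ^ c <= #|T| ->
  (uniform_prob P >= 1 - n%:R ^- c)%R.
Proof.
move=> T0 n0 BP le_B; rewrite /uniform_prob.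
have le_T : #|T| <= #|[set x | `[< P x >]]| + #|B|.
  rewrite -cardsT addnC (leq_trans _ (leq_card_setU _ _)) //.
  apply/subset_leq_card/subsetP => x _.
  by rewrite !inE; case: (boolP (x \in B)) => //= /BP Px; apply/asboolP.
have T0' : (0 < #|T|%:R :> rat)%R by rewrite ltr0n.
have nc0 : (0 < n%:R ^+ c :> rat)%R by rewrite exprn_gt0 // ltr0n.
rewrite ler_pdivlMr // mulrBl mul1r lerBlDr.
rewrite (@le_trans _ _ (#|[set x | `[< P x >]]| + #|B|)%:R%R) //.
  by rewrite ler_nat.
by rewrite natrD lerD2l mulrC ler_pdivlMr // -natrX -natrM ler_nat.
Qed.

(* An algorithm A that is correct on every stream and, on G(n,m), with high
   probability uses O(n log n) words of O(log n) bits (that is, words < n ^ k)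
   throughout the pass, initialization and queries included.  [trunc_log 2 n]
   is the integer part of log_2 n. *)
Theorem theorem7p3 :
  exists (A : algorithm) (k : nat),
    (forall (n m : nat) (s : {perm diedge n}),
       exists S W : nat, maintains_strong_connectivity A S W (stream m s)) /\
    (forall c : nat, exists C : nat, forall n m : nat,
       1 < n -> m <= n * (n - 1) ->
       (uniform_prob (fun s : {perm diedge n} =>
              maintains_strong_connectivity A
                (C * (n * trunc_log 2 n)) (n ^ k) (stream m s))
        >= 1 - n%:R ^- c)%R).
Proof.
exists strong_connectivity, 6; split=> [n m s|c].
  (* Here the bounds may depend on the stream, so they are read off from its number of kept
     edges. *)
  exists (7 + n + 2 * size (kept (stream m s))), (7 + n + 2 * size (kept (stream m s))).+1.
  exact: (maintains_kept (leqnn _) (leqnn _)).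
(* The term 8 (c + 2) pays for the two cells of each of the [L] stored edges; 16 absorbs the 7 + n
   remaining cells. *)
exists (16 + 8 * (c + 2)) => n m n1 le_m.
pose L := 4 * (n * trunc_log 2 n) * (c + 2).
have size_stream k (s : {perm diedge n}) : size (stream k s) <= k.
  by rewrite size_take_min geq_minl.
have l0 : 0 < trunc_log 2 n by rewrite trunc_log_gt0.
have maintained (s : {perm diedge n}) : size (kept (stream m s)) <= L ->
    maintains_strong_connectivity strong_connectivity
    ((16 + 8 * (c + 2)) * (n * trunc_log 2 n)) (n ^ 6) (stream m s).
  move=> keptL; apply: (maintains_kept _ _ (leqnn _)).
    move: keptL; have : n <= n * trunc_log 2 n by rewrite leq_pmulr.
    by rewrite /L; move: (size _) (n * _) => k x; nia.
  (* The word bound uses m <= n (n - 1): all addresses are below 16 n^2, and 16 <= n^4 gives the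
     exponent 6. *)
  have kept_m := leq_trans (size_kept _) (size_stream m s).
  apply: (@leq_trans (2 ^ 4 * n ^ 2)); last first.
    by rewrite (_ : 6 = 4 + 2) // expnD leq_mul2r leq_exp2r // n1 orbT.
  move: (leq_trans kept_m le_m); rewrite !expnS; move: (size _) => k; nia.
pose bad := [set s : {perm diedge n} |
  [exists u, exists v, ~~ strongly_connected (stream L s) u v]].
have T0 : 0 < #|{perm diedge n}| by apply/card_gt0P; exists 1%g.
(* A stream of at most [L] edges satisfies the bound surely, so the exceptional set is empty;
   otherwise its first [L] edges decide. *)
have [le_mL|lt_Lm] := leqP m L.
  apply: (uniform_prob_ge (B := set0)) => //; first exact: ltnW.
    by move=> s _; apply/maintained/(leq_trans (size_kept _))/(leq_trans (size_stream _ _)).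
  by rewrite cards0.
apply: (uniform_prob_ge (B := bad)) => //; first exact: ltnW.
  move=> s; rewrite inE => con; apply: maintained.
  have {}con u v : connect (adj (stream L s)) u v.
    apply: contraNT con => nuv; apply/existsP; exists u; apply/existsP; exists v.
    by apply: contraNN nuv => /andP[].
  rewrite -(cat_take_drop L (stream m s)) -take_min (minn_idPl (ltnW lt_Lm)) kept_cat //.
  exact: leq_trans (size_kept _) (size_stream _ _).
by apply: card_not_strongly_connected => //; apply: leq_trans (ltnW lt_Lm) le_m.
Qed.
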